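(* Let $X$ be a complex $2$-code in $\Omega(d)$ with $A(X)=\left\{\frac{d-1+\sqrt{-1}}{d},\frac{d-1-\sqrt{-1}}{d}\right\}$. If $d\ge 5$, then $|X|<6$.
   Context: $\Omega(d)=\{x\in\mathbb{C}^d\mid x^*x=1\}$ is the unit sphere in $\mathbb{C}^d$, where $x^*$ is the conjugate transpose. For $X\subseteq\Omega(d)$, $A(X)=\{a^*b\mid a,b\in X,\ a\neq b\}$. A complex $2$-code is a finite set $X\subset\Omega(d)$ with $|A(X)|=2$. *)

(* Defs.v *)
From mathcomp Require Import all_boot all_order all_algebra finmap.
From mathcomp Require Import reals.
From mathcomp.real_closed Require Import complex.

Set Implicit Arguments.
Unset Strict Implicit.
Unset Printing Implicit Defensive.

Import GRing.Theory Num.Theory.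

Local Open Scope ring_scope.
Local Open Scope fset_scope.
Local Open Scope sesquilinear_scope.
Local Open Scope complex_scope.

Section ComplexCodes.

Variables (R : realType) (d : nat).
Implicit Types (a b x : 'cV[R[i]]_d) (X : {fset 'cV[R[i]]_d}).

(* The scalar a^* b, conjugate-linear in the first argument. *)
Definition hdot a b : R[i] := (a ^t* *m b) 0 0.

Definition Omega : pred 'cV[R[i]]_d := [pred x | hdot x x == 1].

Definition inner_products X : {fset R[i]} :=
  [fset hdot a b | a in X, b in X & a != b].

Definition complex_2code X : Prop :=
  {subset X <= Omega} /\ #|` inner_products X| = 2%N.

End ComplexCodes.

(* Main.v *)
Require Import Defs.
From mathcomp Require Import all_boot all_order all_algebra finmap.
From mathcomp Require Import reals.
From mathcomp.real_closed Require Import complex.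
From mathcomp Require Import zify ring.

(** Let [n] be the size of [X] and [G] its Gram matrix.  The two admissible
    inner products give [d G = 1 + (d-1) J + 'i S], where [J] is the all-ones
    matrix and [S] is real, skew-symmetric, with entries [1] and [-1] off the
    diagonal: the matrix of a tournament.  Let [P = 1 - J/n] be the orthogonal
    projection onto the sum-zero vectors and [B = P S P].  Since [P] kills [J],
    [P (d G) P = P + 'i B] is positive semidefinite; its spectrum on the
    sum-zero vectors is [1 + t] for [t] an eigenvalue of ['i B], and this set of
    [t]'s is symmetric about [0] as [B] is real and skew.  Hence every [t] lies
    between [-1] and [1], and the squared Frobenius norm of [B], the sum of the
    [t^2], is at most [n - 1].

    On the other hand this norm is [n (n-1) - (2/n) Q], with [Q] the sum of the
    squared row sums (scores) of [S], and counting triples of players gives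
    [3 Q <= n^3].  Together they force [n^2 - 6 n + 3 <= 0], so [n < 6].

    The eigenvalue step is carried out without spectral theory, in
    [gram_centered_sqr]; the combinatorial one is [sum_sqr_scores]. *)

Local Open Scope ring_scope.

Import Order.TTheory GRing.Theory Num.Theory.
Local Open Scope sesquilinear_scope.

(** * Tournament matrices *)

(** Entry [(i, j)] records the outcome of the game between [i] and [j]. *)
Definition tournament_mx {F : numDomainType} {n : nat} (S : 'M[F]_n) :=
  S^T = - S /\ forall i j, i != j -> S i j = 1 \/ S i j = -1.

Lemma trmx_skewE {F : numDomainType} {n : nat} (S : 'M[F]_n) i j :
  S^T = - S -> S j i = - S i j.
Proof. by move/matrixP/(_ i j); rewrite !mxE. Qed.

Lemma skew_diag {F : numDomainType} {n : nat} (S : 'M[F]_n) i :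
  S^T = - S -> S i i = 0.
Proof. by move/(trmx_skewE _ i i)/eqP; rewrite eq_sym eqNr => /eqP. Qed.

Lemma mxtrace_skew {F : numDomainType} {n : nat} (S : 'M[F]_n) :
  S^T = - S -> \tr S = 0.
Proof. by move=> skS; rewrite /mxtrace big1 // => i _; rewrite skew_diag. Qed.

(** For three distinct players the left side is [1] when the triple is
    transitive and [-3] when it is cyclic; when exactly two players coincide only
    the square of one off-diagonal entry survives. *)
Lemma tournament_triple {F : numDomainType} {n : nat} (S : 'M[F]_n) i j k :
  tournament_mx S ->
  S i j * S i k + S j i * S j k + S k i * S k j <= 1.
Proof.
move=> [skS S1]; have skE i' j' := trmx_skewE S i' j' skS.
have S0 i' := skew_diag S i' skS.
rewrite (skE i j) (skE i k) (skE j k).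
have [<-|ij] := eqVneq i j.
  rewrite S0 oppr0 !mul0r !add0r mulrNN.
  have [<-|ik] := eqVneq i k; first by rewrite S0 mul0r ler01.
  by case: (S1 i k ik) => ->; rewrite ?mulrNN mulr1.
have [<-|ik] := eqVneq i k.
  rewrite S0 oppr0 mulr0 mul0r add0r addr0 (skE i j) mulrNN.
  by case: (S1 i j ij) => ->; rewrite ?mulrNN mulr1.
have [<-|jk] := eqVneq j k.
  rewrite S0 oppr0 !mulr0 !addr0.
  by case: (S1 i j ij) => ->; rewrite ?mulrNN mulr1.
have leN3 : -1 - 1 - 1 <= 1 :> F.
  by rewrite (_ : -1 - 1 - 1 = 1 - 4%:R) ?gerBl ?ler0n //; ring.
case: (S1 i j ij) => ->; case: (S1 i k ik) => ->; case: (S1 j k jk) => ->;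
  by rewrite ?(mulrNN, mulrN, mulNr, mulr1, opprK, subrr, addNr,
    add0r, sub0r, addrK, subrK, addNKr).
Qed.

(** Expanding the squared scores gives a sum over all triples; symmetrizing it
    over the player who plays both games produces three copies of it, to which
    [tournament_triple] applies termwise. *)
Lemma sum_sqr_scores {F : numDomainType} {n : nat} (S : 'M[F]_n) :
  tournament_mx S ->
  3%:R * (\sum_i (\sum_j S i j) ^+ 2) <= n%:R ^+ 3.
Proof.
move=> tS; set Q := \sum_i _.
have Q1 : Q = \sum_i \sum_j \sum_k S i j * S i k.
  apply: eq_bigr => i _; rewrite expr2 mulr_suml.
  by apply: eq_bigr => j _; rewrite mulr_sumr.
have Q2 : Q = \sum_i \sum_j \sum_k S j i * S j k by rewrite exchange_big.
have Q3 : Q = \sum_i \sum_j \sum_k S k i * S k j.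
  rewrite Q1 exchange_big; apply: eq_bigr => i _ /=.
  by rewrite exchange_big.
have -> : 3%:R * Q = Q + Q + Q by ring.
rewrite {1}Q1 {1}Q2 Q3.
rewrite -!big_split /=.
have -> : n%:R ^+ 3 = \sum_(i < n) \sum_(j < n) \sum_(k < n) (1 : F).
  by rewrite !sumr_const !card_ord !exprS expr0 mulr1 -!natrM -!mulrnA mulnA.
apply: ler_sum => i _; rewrite -!big_split /=.
apply: ler_sum => j _; rewrite -!big_split /=.
by apply: ler_sum => k _; exact: tournament_triple.
Qed.

Lemma tr_tournament_sqr {F : numDomainType} {n : nat} (S : 'M[F]_n) :
  tournament_mx S -> \tr (S *m S) = n%:R - n%:R ^+ 2.
Proof.
move=> [skS S1].
have -> : n%:R - n%:R ^+ 2 = \sum_(i < n) (1 - n%:R) :> F.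
  by rewrite sumr_const card_ord -mulr_natl; ring.
rewrite /mxtrace; apply: eq_bigr => i _; rewrite mxE (bigD1 i) //=.
rewrite (skew_diag _ _ skS) mul0r add0r.
rewrite (eq_bigr (fun=> -1)) => [|j ji].
  rewrite sumr_const cardC1 card_ord mulNrn -opprB; congr (- _).
  by case: n i S skS S1 => [[]//|n] _ _ _ _; rewrite /= -natr1 addrK.
rewrite (trmx_skewE _ i j skS).
by case: (S1 i j _) => [|->|->]; rewrite 1?eq_sym // ?mulrNN ?mulrN mulr1.
Qed.

(** * The centering projection *)

Definition centering (F : numFieldType) n : 'M[F]_n :=
  1%:M - n%:R^-1 *: const_mx 1.

Definition double_centering {F : numFieldType} {n : nat} (S : 'M[F]_n) :=
  centering F n *m S *m centering F n.

Section Centering.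
Variables (F : numFieldType) (n : nat).
Hypothesis n_gt0 : (0 < n)%N.
Local Notation P := (centering F n).
Local Notation J := (const_mx 1 : 'M[F]_n).

Lemma mulmx_ones : J *m J = n%:R *: J.
Proof.
apply/matrixP=> i j; rewrite !mxE (eq_bigr (fun=> 1)).
  by rewrite sumr_const card_ord mulr1.
by move=> k _; rewrite !mxE mulr1.
Qed.

Lemma centering_ones : P *m J = 0.
Proof.
rewrite /centering mulmxBl mul1mx -scalemxAl mulmx_ones scalerA mulVf.
  by rewrite scale1r subrr.
by rewrite pnatr_eq0 -lt0n.
Qed.

Lemma trmx_centering : P^T = P.
Proof. by rewrite linearB linearZ /= trmx1 trmx_const. Qed.

Lemma centering_idem : P *m P = P.
Proof.
rewrite {2}/centering mulmxBr mulmx1 -scalemxAr centering_ones.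
by rewrite scaler0 subr0.
Qed.

Lemma mxtrace_centering : \tr P = n%:R - 1.
Proof.
rewrite linearB linearZ /= mxtrace1; congr (_ - _).
rewrite /mxtrace (eq_bigr (fun=> 1)) => [|i _]; last by rewrite mxE.
by rewrite sumr_const card_ord mulVf // pnatr_eq0 -lt0n.
Qed.

(** The product is a constant matrix, and it is skew, so its diagonal entry
    vanishes. *)
Lemma ones_skew_ones (S : 'M[F]_n) : S^T = - S -> J *m S *m J = 0.
Proof.
move=> skS; set M := _ *m _.
have JSJ i j : M i j = \sum_k \sum_l S l k.
  rewrite mxE; apply: eq_bigr => k _; rewrite !mxE mulr1.
  by apply: eq_bigr => l _; rewrite mxE mul1r.
have skM : M^T = - M.
  by rewrite /M !trmx_mul trmx_const skS mulmxA mulmxN mulNmx.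
by apply/matrixP=> i j; rewrite [RHS]mxE JSJ -(JSJ i i) skew_diag.
Qed.

Lemma mxtrace_ones_sqr (S : 'M[F]_n) : S^T = - S ->
  \tr (S *m J *m S) = - \sum_i (\sum_j S i j) ^+ 2.
Proof.
move=> skS; rewrite /mxtrace -sumrN; apply: eq_bigr => i _.
rewrite mxE expr2 mulr_sumr -sumrN; apply: eq_bigr => j _.
rewrite !mxE (trmx_skewE _ i j skS) mulrN; congr (- (_ * _)).
by apply: eq_bigr => k _; rewrite mxE mulr1.
Qed.

(** By cyclicity the trace is that of [S P S P]; of the four terms obtained by
    expanding [P = 1 - J/n], the two mixed ones produce the scores and the last
    one contains [J S J = 0]. *)
Lemma mxtrace_centered_sqr (S : 'M[F]_n) : S^T = - S ->
  \tr (double_centering S *m double_centering S) =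
  \tr (S *m S) + 2%:R / n%:R * \sum_i (\sum_j S i j) ^+ 2.
Proof.
move=> skS.
have -> : \tr (double_centering S *m double_centering S) =
    \tr ((S *m P) *m (S *m P)).
  rewrite /double_centering -!mulmxA mxtrace_mulC !mulmxA.
  by rewrite -(mulmxA S P P) centering_idem -(mulmxA _ P P) centering_idem.
rewrite {1 2}/centering !mulmxBr !mulmx1 !mulmxBl -!scalemxAr -!scalemxAl.
rewrite [(S *m J) *m (S *m J)]mulmxA -(mulmxA S J S) -(mulmxA S).
rewrite ones_skew_ones // mulmx0 !scaler0 subr0.
rewrite !linearB !linearZ /= !mulmxA -(mulmxA S S) (mxtrace_mulC S (S *m J)).
by rewrite mxtrace_ones_sqr //; ring.
Qed.
End Centering.

(** * Gram matrices *)

Lemma mxtrace_gram_ge0 {C : numClosedFieldType} {m n} (A : 'M[C]_(m, n)) :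
  0 <= \tr (A^t* *m A).
Proof.
apply: sumr_ge0 => i _; rewrite mxE; apply: sumr_ge0 => j _.
by rewrite !mxE mulrC mul_conjC_ge0.
Qed.

Lemma map_conj_sign {C : numClosedFieldType} {n : nat} (S : 'M[C]_n) :
  (forall i, S i i = 0) -> (forall i j, i != j -> S i j = 1 \/ S i j = -1) ->
  map_mx Num.conj S = S.
Proof.
move=> S0 S1; apply/matrixP=> i j; rewrite mxE.
have [<-|ij] := eqVneq i j; first by rewrite S0 rmorph0.
by case: (S1 i j ij) => ->; rewrite ?rmorphN rmorph1.
Qed.

Lemma trmxC_mul {C : numClosedFieldType} {m n p}
    (A : 'M[C]_(m, n)) (B : 'M_(n, p)) :
  (A *m B)^t* = B^t* *m A^t*.
Proof. by rewrite trmx_mul map_mxM. Qed.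

(** For a real skew [S] the trace below is minus the squared Frobenius norm of
    its centering [B], which is thus bounded by [n - 1].  With [W = P - 'i B],
    the conjugate of the centered Gram matrix [P + 'i B], the matrix [W (a G) W]
    has nonnegative trace.  As [W (P + 'i B) = P + B^2], this matrix equals
    [P + B^2] up to the terms [-'i B] and [-'i B^3], which are traceless because
    [B] is skew. *)
Lemma gram_centered_sqr {C : numClosedFieldType} {d n : nat}
    (V : 'M[C]_(d, n)) (S : 'M[C]_n) (a c : C) :
  (0 < n)%N -> 0 <= a -> S^T = - S -> map_mx Num.conj S = S ->
  a *: (V^t* *m V) = 1%:M + c *: const_mx 1 + 'i *: S ->
  0 <= n%:R - 1 + \tr (double_centering S *m double_centering S).
Proof.
move=> n_gt0 a_ge0 skS realS gramV; set B := double_centering S.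
pose P := centering C n; have BE : B = P *m S *m P by [].
have idP : P *m P = P by exact: centering_idem.
have PJ : P *m const_mx 1 = 0 :> 'M_n by exact: centering_ones.
have trP : \tr P = n%:R - 1 by exact: mxtrace_centering.
have symP : P^T = P by exact: trmx_centering.
have realP : map_mx Num.conj P = P.
  apply/matrixP=> i j; rewrite !mxE rmorphB rmorphM fmorphV !rmorph_nat.
  by rewrite rmorph1.
clearbody B P.
have PB : P *m B = B by rewrite BE !mulmxA idP.
have BP : B *m P = B by rewrite BE -!mulmxA idP.
have skB : B^T = - B by rewrite BE !trmx_mul symP skS mulmxA mulmxN mulNmx.
have realB : map_mx Num.conj B = B by rewrite BE !map_mxM realP realS.
pose W := P - 'i *: B.
have hermW : W^t* = W.
  rewrite /W linearB linearZ /= symP skB map_mxB map_mxZ map_mxN.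
  by rewrite realP realB /= conjCi scalerN scaleNr opprK.
have WP : W *m P = W by rewrite /W mulmxBl -scalemxAl BP idP.
have PW : P *m W = W by rewrite /W mulmxBr -scalemxAr PB idP.
have gramP : P *m (a *: (V^t* *m V)) *m P = P + 'i *: B.
  rewrite gramV !mulmxDr mulmx1 -!scalemxAr PJ scaler0 addr0.
  by rewrite mulmxDl idP -scalemxAl -BE.
have -> : n%:R - 1 + \tr (B *m B) = a * \tr ((V *m W)^t* *m (V *m W)).
  rewrite trmxC_mul hermW -mxtraceZ.
  have -> : a *: (W *m V^t* *m (V *m W)) = W *m (P + 'i *: B) *m W.
    rewrite -gramP !mulmxA WP -!mulmxA PW -scalemxAl -scalemxAr.
    by rewrite !mulmxA.
  have -> : W *m (P + 'i *: B) = P + B *m B.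
    rewrite /W mulmxDr !mulmxBl -!scalemxAl -!scalemxAr idP BP PB.
    by rewrite scalerA -expr2 sqrCi scaleN1r opprK addrA subrK.
  rewrite /W mulmxBr mulmxDl idP -mulmxA BP -!scalemxAr mulmxDl PB.
  rewrite linearB linearZ !linearD /= trP.
  rewrite (mxtrace_skew _ skB) (mxtrace_skew (B *m B *m B)).
    by rewrite addr0 mulr0 subr0.
  by rewrite !trmx_mul skB !(mulmxN, mulNmx) !opprK mulmxA.
by rewrite mulr_ge0 // mxtrace_gram_ge0.
Qed.

(** The parameter [c] is arbitrary because centering removes [c J]. *)
Lemma tournament_gram_size {C : numClosedFieldType} {d n : nat}
    (V : 'M[C]_(d, n)) (S : 'M[C]_n) (a c : C) :
  0 <= a -> tournament_mx S ->
  a *: (V^t* *m V) = 1%:M + c *: const_mx 1 + 'i *: S ->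
  (n < 6)%N.
Proof.
move=> a_ge0 tS gramV; have [skS S1] := tS.
have [->//|n_gt0] := posnP n.
have realS : map_mx Num.conj S = S.
  by apply: map_conj_sign => // i; exact: skew_diag.
have := gram_centered_sqr _ _ _ _ n_gt0 a_ge0 skS realS gramV.
rewrite mxtrace_centered_sqr // tr_tournament_sqr //.
have := sum_sqr_scores _ tS; set Q := \sum_i _ => leQ.
have n_neq0 : n%:R != 0 :> C by rewrite pnatr_eq0 -lt0n.
have n3 : 0 <= 3%:R * n%:R :> C by rewrite mulr_ge0.
(* Clear the denominators: [1/n] in front of [Q] and [3 Q <= n^3]. *)
move/(mulr_ge0 n3).
have -> : 3%:R * n%:R * (n%:R - 1 + (n%:R - n%:R ^+ 2 + 2%:R / n%:R * Q)) =
    2%:R * (3%:R * Q) + 6%:R * n%:R ^+ 2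
    - (3%:R * n%:R ^+ 3 + 3%:R * n%:R) by field.
rewrite subr_ge0 => ge0.
have: 3%:R * n%:R ^+ 3 + 3%:R * n%:R <=
    2%:R * n%:R ^+ 3 + 6%:R * n%:R ^+ 2 :> C.
  by apply: le_trans ge0 _; rewrite lerD2r ler_wpM2l.
rewrite -!natrX -!natrM -!natrD ler_nat.
nia.
Qed.

(** The equation [a G = 1 + (a - 1) J + 'i S] defines [S].  As [G] is Hermitian,
    the conjugate transpose of [S] is [- S]; the entries of [S] being real, [S]
    is skew and therefore a tournament matrix. *)
Lemma two_inner_products_size {C : numClosedFieldType} {d n : nat}
    (V : 'M[C]_(d, n)) (a : C) :
  0 < a -> (forall i, (V^t* *m V) i i = 1) ->
  (forall i j, i != j -> (V^t* *m V) i j = (a - 1 + 'i) / a \/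
                         (V^t* *m V) i j = (a - 1 - 'i) / a) ->
  (n < 6)%N.
Proof.
move=> a_gt0; set G := V^t* *m V => Gd Gnd.
have hermG i j : (G j i)^* = G i j.
  have : G^t* = G by rewrite /G trmxC_mul trmxCK.
  by move/matrixP/(_ i j); rewrite !mxE.
have a_neq0 : a != 0 by rewrite gt_eqF.
have [S defS] : exists S,
    S = - 'i *: (a *: G - 1%:M - (a - 1) *: const_mx 1) by eexists.
have SE i j : S i j = - 'i * (a * G i j - (i == j)%:R - (a - 1)).
  by rewrite defS !mxE mulr1.
have gramV : a *: G = 1%:M + (a - 1) *: const_mx 1 + 'i *: S.
  rewrite defS scalerA mulrN -expr2 sqrCi opprK scale1r.
  by apply/matrixP=> i j; rewrite !mxE; ring.
apply: (tournament_gram_size V S _ _ (ltW a_gt0) _ gramV).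
have S1 i j : i != j -> S i j = 1 \/ S i j = -1.
  move=> ij; rewrite SE (negPf ij) subr0.
  case: (Gnd i j ij) => ->; [left|right]; rewrite mulrCA divff // mulr1.
    by rewrite addrC addKr mulNr -expr2 sqrCi opprK.
  by rewrite addrC addKr mulrNN -expr2 sqrCi.
have realS : map_mx Num.conj S = S.
  apply: map_conj_sign => // i.
  by rewrite SE eqxx Gd mulr1 subrr mulr0.
split=> //; rewrite -[in LHS]realS; apply/matrixP=> i j.
rewrite !mxE !SE rmorphM rmorphN !rmorphB rmorphM rmorph1 rmorph_nat /=.
by rewrite conjCi hermG (geC0_conj (ltW a_gt0)) eq_sym; ring.
Qed.

Local Open Scope fset_scope.

Theorem theorem4p3 (R : realType) (d : nat) (X : {fset 'cV[R[i]]_d}) :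
  complex_2code X ->
  inner_products X =
    [fset (d%:R - 1 + 'i%C) / d%:R; (d%:R - 1 - 'i%C) / d%:R] ->
  (5 <= d)%N ->
  (#|` X| < 6)%N.
Proof.
move=> [XOmega _] ipX d_ge5; rewrite complexiE in ipX.
pose x (i : 'I_(#|` X|)) := nth 0%R (enum_fset X) i.
have xX i : x i \in X by exact: mem_nth.
have x_inj : injective x.
  move=> i j /eqP; rewrite nth_uniq ?fset_uniq // => /eqP; exact: val_inj.
pose V : 'M[R[i]]_(d, #|` X|) := (\matrix_(k, j) x j k 0)%R.
have gramE i j : ((V^t* *m V) i j = hdot (x i) (x j))%R.
  by rewrite /hdot !mxE; apply: eq_bigr => k _; rewrite !mxE.
apply: (two_inner_products_size V d%:R) => [|i|i j ij].
- by rewrite ltr0n; apply: leq_trans d_ge5.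
- by rewrite gramE; apply/eqP; exact: XOmega.
have : hdot (x i) (x j) \in inner_products X.
  apply/imfset2P; exists (x i); first exact: xX.
  by exists (x j) => //; rewrite !inE xX; apply: contra ij => /eqP/x_inj ->.
by rewrite ipX -gramE !inE => /orP[]/eqP ->; [left|right].
Qed.
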